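(* For every $L>0$ there exists a constant $C=C(L)>0$, depending only on $L$, such that the following holds. Let $X$ be a mean zero random vector in $\mathbb{R}^n$ with covariance matrix $\Sigma=\mathbb{E}XX^{\mathsf T}$. Suppose $X$ is sub-gaussian, and more specifically $$\|\langle X,x\rangle\|_{\psi_2}\le L\,\|\langle X,x\rangle\|_{L^2}=L\,\|\Sigma^{1/2}x\|_2\quad\text{for any }x\in\mathbb{R}^n.$$ Then, for every $N\ge1$, $$\mathbb{E}\|\Sigma_N-\Sigma\|\le C\,\|\Sigma\|\left(\sqrt{\frac nN}+\frac nN\right),$$ where $\Sigma_N:=\frac1N\sum_{i=1}^NX_iX_i^{\mathsf T}$ and $X_1,\dots,X_N$ are independent copies of $X$.
   Context: $\|\cdot\|_2$ is the Euclidean norm and $\|\cdot\|$ is the operator norm of a matrix with respect to the Euclidean norm. For a real random variable $Z$, $\|Z\|_{L^2}=(\mathbb{E}Z^2)^{1/2}$ and the sub-gaussian norm is $\|Z\|_{\psi_2}:=\inf\{t>0:\ \mathbb{E}\exp(Z^2/t^2)\le 2\}$; $Z$ is sub-gaussian if $\|Z\|_{\psi_2}<\infty$. A random vector $X$ in $\mathbb{R}^n$ is sub-gaussian if $\langle X,x\rangle$ is sub-gaussian for every $x\in\mathbb{R}^n$. *)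

(* Defs.v *)
From HB Require Import structures.
From mathcomp Require Import all_boot all_order all_algebra.
From mathcomp Require Import all_classical all_reals all_analysis.
From mathcomp Require Import measurable_realfun.
Import Order.TTheory GRing.Theory Num.Theory.
Import numFieldNormedType.Exports.

Set Implicit Arguments.
Unset Strict Implicit.
Unset Printing Implicit Defensive.

Local Open Scope classical_set_scope.
Local Open Scope ring_scope.

Section LinearAlgebra.
Context {R : realType}.

(* The library norm `|x| on matrices is the sup norm, hence these. *)
Definition enorm n (x : 'cV[R]_n) : R := Num.sqrt (\sum_(i < n) x i 0 ^+ 2).

Definition opnorm m n (A : 'M[R]_(m, n)) : R :=
  sup [set enorm (A *m x) | x in [set x : 'cV[R]_n | enorm x <= 1]].

Definition inner n (u v : 'cV[R]_n) : R := \sum_(i < n) u i 0 * v i 0.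

End LinearAlgebra.

Section Probability.
Context {d : measure_display} {T : measurableType d} {R : realType}.
Variable P : probability T R.

(* The infimum of the empty set is +oo. *)
Definition psi2norm (Z : T -> R) : \bar R :=
  ereal_inf [set t%:E | t in [set t : R | 0 < t /\
    ('E_P[fun w => expR (Z w ^+ 2 / t ^+ 2)] <= 2%:E)%E]].

Definition L2norm (Z : T -> R) : \bar R := ('N[P]_(2%:E)[EFin \o Z])%E.

Definition subgaussian (Z : T -> R) : Prop := (psi2norm Z < +oo)%E.

(* fine maps infinite values to 0: only meaningful for integrable entries. *)
Definition mean_mx m n (M : T -> 'M[R]_(m, n)) : 'M[R]_(m, n) :=
  \matrix_(i, j) fine ('E_P[fun w => M w i j])%E.

Definition mutually_independent {d'} {T' : measurableType d'} {I : finType}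
    (Y : I -> {mfun T >-> T'}) : Prop :=
  forall (J : {set I}) (A : I -> set T'), (forall i, measurable (A i)) ->
    P (\bigcap_(i in [set` J]) (Y i @^-1` A i)) =
    (\prod_(i in J) P (Y i @^-1` A i))%E.

(* A random vector in R^n is a random variable valued in n.-tuple R, whose
   product sigma-algebra is the Borel one; vec turns it into a column. *)
Definition vec n (X : {RV P >-> n.-tuple R}) (w : T) : 'cV[R]_n :=
  \col_i tnth (X w) i.

Definition subgaussian_vector n (X : {RV P >-> n.-tuple R}) : Prop :=
  forall x : 'cV[R]_n, subgaussian (fun w => inner (vec X w) x).

Definition mean_zero n (X : {RV P >-> n.-tuple R}) : Prop :=
  forall i : 'I_n, ('E_P[fun w => tnth (X w) i] = 0)%E.

Definition covmx n (X : {RV P >-> n.-tuple R}) : 'M[R]_n :=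
  mean_mx (fun w => vec X w *m (vec X w)^T).

Definition sample_covmx n N (Xs : 'I_N -> {RV P >-> n.-tuple R}) (w : T) :
    'M[R]_n :=
  N%:R^-1 *: \sum_(i < N) vec (Xs i) w *m (vec (Xs i) w)^T.

Definition independent_copies n N (X : {RV P >-> n.-tuple R})
    (Xs : 'I_N -> {RV P >-> n.-tuple R}) : Prop :=
  mutually_independent Xs /\
  forall i (A : set (n.-tuple R)), measurable A ->
    distribution P (Xs i) A = distribution P X A.

Lemma subgaussian_integrable_sqr (Z : T -> R) :
  measurable_fun setT Z -> subgaussian Z ->
  P.-integrable setT (fun w => (Z w ^+ 2)%:E).
Proof.
move=> mZ /ereal_inf_lt[_ [t [t0 tE] <-] _].
have mE : measurable_fun setT (fun w => expR (Z w ^+ 2 / t ^+ 2)).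
  apply: measurableT_comp => //; apply: measurable_funM => //.
  exact: measurable_funX.
have iE : P.-integrable setT (fun w => (expR (Z w ^+ 2 / t ^+ 2))%:E).
  apply/integrableP; split; first exact/measurable_EFinP.
  under eq_integral do rewrite gee0_abs ?lee_fin ?expR_ge0//.
  rewrite unlock in tE.
  by apply: le_lt_trans tE _; rewrite ltry.
have := integrableZl measurableT (t ^+ 2) iE.
apply: le_integrable => //.
  by apply/measurable_EFinP; exact: measurable_funX.
move=> w _; rewrite /= lee_fin !ger0_norm ?sqr_ge0//; last first.
  by rewrite mulr_ge0 ?sqr_ge0 ?expR_ge0.
rewrite -ler_pdivrMl ?exprn_gt0// mulrC.
by apply: le_trans (expR_ge1Dx _); rewrite lerDr.
Qed.

(* With S = Sigma^{1/2}, this is |<X, x>|_{L^2} = |Sigma^{1/2} x|_2. *)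
Lemma L2norm_inner n (X : {RV P >-> n.-tuple R}) (S : 'M[R]_n) (x : 'cV[R]_n) :
  subgaussian_vector X -> S^T = S -> S *m S = covmx X ->
  L2norm (fun w => inner (vec X w) x) = (enorm (S *m x))%:E.
Proof.
move=> sgX ST SS.
have mX i : measurable_fun setT (fun w => tnth (X w) i).
  exact: (measurableT_comp (measurable_tnth i)).
have iX2 i : P.-integrable setT (fun w => (tnth (X w) i ^+ 2)%:E).
  apply: subgaussian_integrable_sqr => //.
  have := sgX (delta_mx i 0); congr subgaussian; apply/funext => w.
  rewrite /inner (bigD1 i)//= big1 ?addr0 => [|j ji].
    by rewrite !mxE !eqxx mulr1.
  by rewrite !mxE (negbTE ji) mulr0.
have iXX i j : P.-integrable setT (fun w => (tnth (X w) i * tnth (X w) j)%:E).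
  have := integrableD measurableT (iX2 i) (iX2 j).
  apply: le_integrable => //.
    by apply/measurable_EFinP; exact: measurable_funM.
  move=> w _ /=; rewrite lee_fin [leRHS]ger0_norm ?addr_ge0 ?sqr_ge0//.
  rewrite normrM -(real_normK (num_real (tnth (X w) i))).
  rewrite -(real_normK (num_real (tnth (X w) j))).
  set a := `|tnth (X w) i|; set b := `|tnth (X w) j|.
  have a0 : 0 <= a by exact: normr_ge0.
  have b0 : 0 <= b by exact: normr_ge0.
  have := sqr_ge0 (a - b); rewrite sqrrB addrAC subr_ge0.
  apply: le_trans; rewrite mulr2n lerDl.
  exact: mulr_ge0.
have covE i j : (\int[P]_w (tnth (X w) i * tnth (X w) j)%:E)%E =
    (covmx X i j)%:E.
  rewrite mxE unlock fineK.
    apply: eq_integral => w _; congr EFin.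
    by rewrite !mxE big_ord1 !mxE.
  under eq_integral do rewrite mxE big_ord1 !mxE.
  exact: integrable_fin_num.
rewrite /L2norm unlock poweR12_sqrt; last first.
  by apply: integral_ge0 => w _; exact: poweR_ge0.
have -> : (\int[P]_w (`|(EFin \o (fun w => inner (vec X w) x)) w| `^ 2))%E =
    (\int[P]_w \sum_(p : 'I_n * 'I_n)
      ((x p.1 0 * x p.2 0)%:E * (tnth (X w) p.1 * tnth (X w) p.2)%:E))%E.
  apply: eq_integral => w _ /=.
  rewrite powR_mulrn// real_normK ?num_real// sumEFin; congr EFin.
  rewrite expr2 /inner big_distrlr pair_bigA/=; apply: eq_bigr => p _.
  by rewrite !mxE mulrACA mulrC.
rewrite integral_sum//; last by move=> p; exact: integrableZl.
under eq_bigr do rewrite integralZl// covE -EFinM.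
rewrite sumEFin /=; congr (Num.sqrt _)%:E.
have -> : \sum_(i < n) (S *m x) i 0 ^+ 2 = ((S *m x)^T *m (S *m x)) 0 0.
  by rewrite [RHS]mxE; apply: eq_bigr => i _; rewrite expr2 [_^T _ _]mxE.
rewrite trmx_mul ST mulmxA -(mulmxA x^T) SS mxE.
under [RHS]eq_bigr do rewrite mxE mulr_suml.
rewrite exchange_big pair_bigA/=; apply: eq_bigr => p _.
by rewrite !mxE mulrAC.
Qed.

End Probability.

(* Main.v *)
Require Import Defs.
From HB Require Import structures.
From mathcomp Require Import all_boot all_order all_algebra.
From mathcomp Require Import all_classical all_reals all_analysis.
From mathcomp Require Import measurable_realfun.
From mathcomp Require Import ring lra.
Import Order.TTheory GRing.Theory Num.Theory.
Import numFieldNormedType.Exports.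

Local Open Scope classical_set_scope.
Local Open Scope ring_scope.

Set Implicit Arguments.
Unset Strict Implicit.
Unset Printing Implicit Defensive.

(* For a symmetric matrix A, |A| <= 4 max |<y, A y>| over a 1/8-net of the unit
   ball.  The net is the set of points of the lattice (8 sqrt n)^-1 Z^n with
   integer coordinates z satisfying sum z_i^2 <= 64 n; it has at most 2^(66 n)
   points.  Fix K > L |Sigma|^(1/2).  For y in the net, Y = <X, y>^2 / K^2
   satisfies E e^Y <= 2, hence E e^(l (Y - E Y)) <= e^(c l^2) for |l| <= 1/2,
   with c = 32 e, and by independence the centred sum D_y over the sample
   satisfies E e^(l D_y) <= e^(N c l^2).  Summing over the net and over the two
   signs gives l E max |D_y| <= N c l^2 + 67 n, and l = min(1, sqrt(n/N)) / 2
   yields the bound with K^2 in place of L^2 |Sigma|; finally K decreases to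
   L |Sigma|^(1/2). *)

(** * Operator norm and nets *)

Section Euclidean.
Context {R : realType}.

Lemma innerC n (u v : 'cV[R]_n) : inner u v = inner v u.
Proof. by apply: eq_bigr => i _; rewrite mulrC. Qed.

Lemma innerDl n (u v w : 'cV[R]_n) : inner (u + v) w = inner u w + inner v w.
Proof.
by rewrite /inner -big_split; apply: eq_bigr => i _; rewrite mxE mulrDl.
Qed.

Lemma innerZl n a (u w : 'cV[R]_n) : inner (a *: u) w = a * inner u w.
Proof. by rewrite /inner mulr_sumr; apply: eq_bigr => i _; rewrite mxE mulrA. Qed.

Lemma innerBl n (u v w : 'cV[R]_n) : inner (u - v) w = inner u w - inner v w.
Proof. by rewrite -scaleN1r innerDl innerZl mulN1r. Qed.

Lemma innerDr n (u v w : 'cV[R]_n) : inner w (u + v) = inner w u + inner w v.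
Proof. by rewrite ![inner w _]innerC innerDl. Qed.

Lemma innerBr n (u v w : 'cV[R]_n) : inner w (u - v) = inner w u - inner w v.
Proof. by rewrite ![inner w _]innerC innerBl. Qed.

Lemma innerZr n a (u w : 'cV[R]_n) : inner w (a *: u) = a * inner w u.
Proof. by rewrite ![inner w _]innerC innerZl. Qed.

Lemma inner_mulmx_tr m n (A : 'M[R]_(m, n)) u v :
  inner u (A *m v) = inner (A^T *m u) v.
Proof.
rewrite /inner; under eq_bigr do rewrite mxE mulr_sumr.
rewrite exchange_big; apply: eq_bigr => i _ /=; rewrite mxE mulr_suml.
by apply: eq_bigr => j _; rewrite !mxE mulrA (mulrC (u j 0)).
Qed.

Lemma inner_sumr n (u : 'cV[R]_n) (I : finType) (F : I -> 'cV[R]_n) :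
  inner u (\sum_i F i) = \sum_i inner u (F i).
Proof.
rewrite /inner exchange_big; apply: eq_bigr => j _ /=.
by rewrite summxE mulr_sumr.
Qed.

Lemma inner_outer n (v y : 'cV[R]_n) : inner y (v *m v^T *m y) = inner v y ^+ 2.
Proof.
rewrite -mulmxA (mx11_scalar (v^T *m y)) mul_mx_scalar innerZr innerC expr2.
by congr (_ * _); rewrite mxE; apply: eq_bigr => i _; rewrite mxE.
Qed.

Lemma enorm_ge0 n (x : 'cV[R]_n) : 0 <= enorm x.
Proof. exact: sqrtr_ge0. Qed.

Lemma enorm_sqr n (x : 'cV[R]_n) : enorm x ^+ 2 = inner x x.
Proof. by rewrite sqr_sqrtr ?sumr_ge0// => i _; exact: sqr_ge0. Qed.

Lemma enorm_le n (x : 'cV[R]_n) c : 0 <= c -> inner x x <= c ^+ 2 -> enorm x <= c.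
Proof. by move=> c0; rewrite -enorm_sqr ler_pXn2r// nnegrE enorm_ge0. Qed.

Lemma enorm0_eq0 n (x : 'cV[R]_n) : enorm x = 0 -> x = 0.
Proof.
move=> x0; have := enorm_sqr x; rewrite x0 expr0n => /esym/eqP.
rewrite psumr_eq0 => [/allP h|i _]; last by rewrite -expr2 sqr_ge0.
apply/colP => i; rewrite mxE.
by have := h i (mem_index_enum _); rewrite -expr2 sqrf_eq0 => /eqP.
Qed.

Lemma enormZ n a (x : 'cV[R]_n) : enorm (a *: x) = `|a| * enorm x.
Proof.
apply/eqP; rewrite -(@eqrXn2 _ 2) ?mulr_ge0 ?enorm_ge0//.
by rewrite exprMn !enorm_sqr innerZl innerZr real_normK ?num_real// expr2 mulrA.
Qed.

(** Cauchy-Schwarz: for nonzero u and v, expand the squared norm of |v| u - |u| v and divide by |u|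
    |v|. *)
Lemma inner_le_enorm n (u v : 'cV[R]_n) : inner u v <= enorm u * enorm v.
Proof.
have [u0|u0] := eqVneq (enorm u) 0.
  by rewrite u0 (enorm0_eq0 u0) mul0r -(scale0r 0) innerZl mul0r.
have [v0|v0] := eqVneq (enorm v) 0.
  by rewrite v0 (enorm0_eq0 v0) mulr0 -(scale0r 0) innerZr mul0r.
have uv : 0 < enorm u * enorm v by rewrite mulr_gt0// lt0r enorm_ge0 andbT.
have := sqr_ge0 (enorm (enorm v *: u - enorm u *: v)).
rewrite enorm_sqr innerBl !innerBr !innerZl !innerZr -!enorm_sqr (innerC v u).
move=> h; rewrite -(ler_pM2l uv); nra.
Qed.

Lemma normr_inner_le n (u v : 'cV[R]_n) : `|inner u v| <= enorm u * enorm v.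
Proof.
rewrite ler_norml inner_le_enorm andbT lerNl -mulN1r -innerZl.
by rewrite (le_trans (inner_le_enorm _ _))// enormZ normrN1 mul1r.
Qed.

Lemma enormD n (u v : 'cV[R]_n) : enorm (u + v) <= enorm u + enorm v.
Proof.
apply: enorm_le; first by rewrite addr_ge0 ?enorm_ge0.
rewrite innerDl !innerDr -!enorm_sqr (innerC v u).
by have := inner_le_enorm u v; nra.
Qed.

Lemma enormN n (u : 'cV[R]_n) : enorm (- u) = enorm u.
Proof. by rewrite -scaleN1r enormZ normrN1 mul1r. Qed.

Lemma enorm0 n : enorm (0 : 'cV[R]_n) = 0.
Proof. by rewrite -(scale0r 0) enormZ normr0 mul0r. Qed.

(** [sup] takes a default value on unbounded sets, so [opnorm] is usable only once the set is known
    to be bounded. Cauchy-Schwarz on each row bounds it by the Frobenius norm. *)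
Lemma has_sup_opnorm m n (A : 'M[R]_(m, n)) :
  has_sup [set enorm (A *m x) | x in [set x : 'cV[R]_n | enorm x <= 1]].
Proof.
split; first by exists (enorm (A *m 0)), 0 => //=; rewrite enorm0.
exists (Num.sqrt (\sum_i enorm ((row i A)^T) ^+ 2)) => _ [x /= x1 <-].
rewrite ler_wsqrtr// ler_sum// => i _.
have -> : (A *m x) i 0 = inner ((row i A)^T) x.
  by rewrite mxE; apply: eq_bigr => j _; rewrite !mxE.
rewrite -real_normK ?num_real// ler_pXn2r ?nnegrE ?enorm_ge0//.
by rewrite (le_trans (normr_inner_le _ _))// ler_piMr ?enorm_ge0.
Qed.

Lemma opnorm_ge0 m n (A : 'M[R]_(m, n)) : 0 <= opnorm A.
Proof.
apply: (@le_trans _ _ (enorm (A *m 0))); first exact: enorm_ge0.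
apply: (ub_le_sup (has_sup_opnorm A).2).
by exists 0 => //=; rewrite enorm0.
Qed.

Lemma enorm_mulmx_le m n (A : 'M[R]_(m, n)) x :
  enorm (A *m x) <= opnorm A * enorm x.
Proof.
have [x0|x0] := eqVneq (enorm x) 0.
  by rewrite x0 (enorm0_eq0 x0) mulmx0 enorm0 mulr0.
have xp : 0 < enorm x by rewrite lt0r x0 enorm_ge0.
rewrite -ler_pdivrMr// mulrC -[X in X * _]gtr0_norm ?invr_gt0//.
rewrite -enormZ scalemxAr; apply: (ub_le_sup (has_sup_opnorm A).2).
by exists ((enorm x)^-1 *: x) => //=; rewrite enormZ gtr0_norm ?invr_gt0// mulVf.
Qed.

Lemma opnorm_le m n (A : 'M[R]_(m, n)) c :
  (forall x, enorm x <= 1 -> enorm (A *m x) <= c) -> opnorm A <= c.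
Proof.
move=> h; apply: ge_sup; first exact: (has_sup_opnorm A).1.
by move=> _ [x /= x1 <-]; exact: h.
Qed.

Lemma opnorm_dim0 (A : 'M[R]_0) : opnorm A = 0.
Proof.
apply/eqP; rewrite eq_le opnorm_ge0 andbT; apply: opnorm_le => x _.
by rewrite /enorm big_ord0 sqrtr0.
Qed.

Lemma normr_bilinear_le n (A : 'M[R]_n) u v :
  `|inner u (A *m v)| <= opnorm A * enorm u * enorm v.
Proof.
apply: (le_trans (normr_inner_le _ _)).
by rewrite mulrAC mulrC ler_wpM2r ?enorm_ge0// enorm_mulmx_le.
Qed.

(** Let M be the operator norm. Replacing u by a net point within 1/8 changes the quadratic form by
    at most 2 M / 8 = M / 4. Polarization passes to the bilinear form at the cost of a factor 2, and
    M <= 2 m + M / 2 is solved for M. *)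
Lemma opnorm_le_net n (A : 'M[R]_n) (D : set 'cV[R]_n) (m : R) :
  A^T = A ->
  (forall u, enorm u <= 1 ->
     exists2 y, D y & enorm y <= 1 /\ enorm (u - y) <= 8^-1) ->
  (forall y, D y -> `|inner y (A *m y)| <= m) ->
  opnorm A <= 4 * m.
Proof.
move=> sA net Dm; set M := opnorm A; have M0 : 0 <= M := opnorm_ge0 A.
have quad u : enorm u <= 1 -> `|inner u (A *m u)| <= m + M / 4.
  move=> u1; have [y Dy [y1 uy]] := net u u1.
  have -> : inner u (A *m u) =
      inner y (A *m y) + inner (u - y) (A *m u) + inner y (A *m (u - y)).
    by rewrite mulmxBr innerBl innerBr; ring.
  have b1 : `|inner (u - y) (A *m u)| <= M / 8.
    apply: le_trans (normr_bilinear_le _ _ _) _; rewrite -/M -mulrA ler_wpM2l//.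
    by rewrite -[leRHS]mulr1 ler_pM ?enorm_ge0.
  have b2 : `|inner y (A *m (u - y))| <= M / 8.
    apply: le_trans (normr_bilinear_le _ _ _) _; rewrite -/M -mulrA ler_wpM2l//.
    by rewrite -[leRHS]mul1r ler_pM ?enorm_ge0.
  apply: le_trans (ler_normD _ _) _.
  have := ler_normD (inner y (A *m y)) (inner (u - y) (A *m u)).
  have := Dm y Dy; lra.
have bil u v : enorm u <= 1 -> enorm v <= 1 ->
    inner u (A *m v) <= 2 * m + M / 2.
  (* Polarization at the half-sum and half-difference, which stay in the unit ball; the identity
     relies on the symmetry of [A]. *)
  move=> u1 v1; pose p : 'cV[R]_n := 2^-1 *: (u + v); pose q : 'cV[R]_n := 2^-1 *: (u - v).
  have p1 : enorm p <= 1.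
    by rewrite enormZ gtr0_norm ?invr_gt0//; have := enormD u v; lra.
  have q1 : enorm q <= 1.
    rewrite enormZ gtr0_norm ?invr_gt0//; have := enormD u (- v).
    by rewrite enormN; lra.
  have -> : inner u (A *m v) = inner p (A *m p) - inner q (A *m q).
    rewrite /p /q -!scalemxAr mulmxDr mulmxBr !innerZl !innerZr.
    rewrite !(innerBl, innerDl) !(innerBr, innerDr).
    by rewrite (inner_mulmx_tr _ v u) sA (innerC _ u); field.
  by have := quad p p1; have := quad q q1; rewrite !ler_norml; lra.
suff : M <= 2 * m + M / 2 by lra.
apply: opnorm_le => x x1; set z := A *m x.
(* The bilinear bound is tested at z / |z| and x. If z = 0, the bounds at x and -x together show
   that the right-hand side is nonnegative. *)
have [z0|z0] := eqVneq (enorm z) 0.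
  rewrite z0; have := bil _ _ x1 x1.
  have := bil (- x) x; rewrite enormN -scaleN1r innerZl => /(_ x1 x1); lra.
have zp : 0 < enorm z by rewrite lt0r z0 enorm_ge0.
have := bil ((enorm z)^-1 *: z) x; rewrite enormZ gtr0_norm ?invr_gt0// mulVf//.
move=> /(_ (lexx _) x1); rewrite innerZl -/z -enorm_sqr expr2 mulrA mulVf//.
by rewrite mul1r.
Qed.

End Euclidean.

(** * Lattice net of the unit ball and its cardinality *)

Section Grid.
Context {R : realType}.

(** Sign and absolute value of integer coordinates; zero has two codes, which only enlarges the
    count. The cap [8 * n] leaves room for the scaled coordinates of a point of the unit ball, which
    are at most 8 sqrt n. *)
Definition grid_index n := {ffun 'I_n -> bool * 'I_(8 * n).+1}.

Definition grid_point n (z : grid_index n) : 'cV[R]_n :=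
  \col_i ((-1) ^+ (z i).1 * (z i).2%:R / (8 * Num.sqrt n%:R)).

Definition grid_ball n : {set grid_index n} :=
  [set z : grid_index n | (\sum_i (z i).2 ^ 2 <= 64 * n)%N].

(* Chernoff-style count: each index in the ball has weight at least 1 under
   [2 ^ (64 n - sum z_i^2)], and the total weight factors over coordinates. *)
Lemma card_grid_ball n : (#|grid_ball n|)%:R <= 2 ^+ (66 * n) :> R.
Proof.
pose h : R := 2^-1; have h0 : 0 <= h by rewrite invr_ge0.
have geom m : \sum_(k < m) h ^+ k = 2 - 2 * h ^+ m.
  elim: m => [|m ih]; first by rewrite big_ord0 expr0; lra.
  rewrite big_ord_recr /= ih exprS /h; lra.
(* There are two signs, and for each the sum of h^(k^2) is at most the geometric sum of h^k, hence
   at most 2. A coordinate contributes 4 = 2^2, whence 66 = 64 + 2. *)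
have coord m : \sum_(p : bool * 'I_m) h ^+ (p.2 ^ 2) <= 2 ^+ 2.
  rewrite -(pair_bigA _ (fun (_ : bool) (k : 'I_m) => h ^+ (k ^ 2))) /=.
  rewrite big_bool /=.
  have : \sum_(k < m) h ^+ (k ^ 2) <= 2.
    apply: (@le_trans _ _ (\sum_(k < m) h ^+ k)).
      apply: ler_sum => k _; apply: ler_wiXn2l => //.
        by rewrite invf_le1// ler1n.
      by rewrite -mulnn; case: (nat_of_ord k) => // j; rewrite leq_pmulr.
    by rewrite geom lerBlDr lerDl mulr_ge0// exprn_ge0.
  lra.
apply: (@le_trans _ _ (\sum_(z : grid_index n)
    2 ^+ (64 * n) * \prod_i h ^+ ((z i).2 ^ 2))).
  rewrite [leRHS](bigID (mem (grid_ball n))) /= -[leLHS]addr0 lerD//; last first.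
    apply: sumr_ge0 => z _; rewrite mulr_ge0 ?exprn_ge0// prodr_ge0// => i _.
    exact: exprn_ge0.
  rewrite -sum1_card natr_sum ler_sum// => z; rewrite inE => zn.
  rewrite -expr_sum -ler_pdivrMl ?exprn_gt0// mulr1 -exprVn.
  by apply: ler_wiXn2l => //; rewrite invf_le1// ler1n.
rewrite -mulr_sumr (mulnDl 64 2 n) exprD ler_wpM2l ?exprn_ge0//.
rewrite -(bigA_distr_bigA (fun (i : 'I_n) (p : bool * 'I_(8 * n).+1) =>
  h ^+ (p.2 ^ 2))) exprM -[X in _ ^+ X]card_ord -prodr_const.
apply: ler_prod => i _; rewrite coord andbT sumr_ge0// => p _.
exact: exprn_ge0.
Qed.

(** The factor 2 accounts for the two signs in the union bound; it fits into one more power of 2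
    because n is positive, and 2 <= e. *)
Lemma two_card_grid_le_expR n : (0 < n)%N ->
  2 * (#|grid_ball n|)%:R <= expR (67 * n%:R) :> R.
Proof.
move=> n0; apply: (@le_trans _ _ (2 ^+ (67 * n))).
  rewrite (_ : 67 = 1 + 66)%N// mulnDl mul1n exprD.
  rewrite ler_pM//; last exact: card_grid_ball.
  by rewrite -[leLHS]expr1; apply: ler_weXn2l => //; rewrite ler1n.
rewrite -natrM -[X in expR X]mulr1 expRM_natl ler_pXn2r ?muln_gt0 ?nnegrE ?expR_ge0//.
by have := expR_ge1Dx (1 : R); lra.
Qed.

Lemma sqrt_natr_sqr n : Num.sqrt n%:R ^+ 2 = n%:R :> R.
Proof. by rewrite sqr_sqrtr. Qed.

Lemma enorm_grid_point n (z : grid_index n) :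
  z \in grid_ball n -> enorm (grid_point z) <= 1.
Proof.
rewrite inE => zn; apply: enorm_le => //.
have [n0|n0] := posnP n.
  by subst n; rewrite /inner big_ord0.
have s2 : (8 * Num.sqrt n%:R) ^+ 2 = 64 * n%:R :> R.
  by rewrite exprMn sqrt_natr_sqr -natrX.
have n0' : 0 < 64 * n%:R :> R by rewrite mulr_gt0 ?ltr0n.
have -> : inner (grid_point z) (grid_point z) =
    (\sum_i (z i).2 ^ 2)%:R / (64 * n%:R).
  rewrite natr_sum mulr_suml; apply: eq_bigr => i _.
  by rewrite mxE -expr2 !exprMn exprVn s2 natrX sqrr_sign mul1r.
by rewrite expr1n ler_pdivrMr// mul1r -natrM ler_nat.
Qed.

(** The coordinates of 8 sqrt n u are rounded towards zero. This cannot increase the sum of squares,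
    so the point stays in the ball, and each of the n coordinates errs by at most 1 / (8 sqrt n), so
    the distance is at most 1/8. *)
Lemma grid_net n (u : 'cV[R]_n) : enorm u <= 1 ->
  exists2 z, z \in grid_ball n & enorm (u - grid_point z) <= 8^-1.
Proof.
move=> u1; have [n0|n0] := posnP n.
  (* In dimension 0 the scale 8 sqrt n vanishes, but all vectors coincide and any index serves. *)
  subst n; exists [ffun=> (true, ord0)]; first by rewrite inE big_ord0.
  by apply: enorm_le => //; rewrite /inner big_ord0 sqr_ge0.
pose s : R := 8 * Num.sqrt n%:R.
have s2 : s ^+ 2 = 64 * n%:R by rewrite exprMn sqrt_natr_sqr -natrX.
have s0 : 0 < s by rewrite mulr_gt0// sqrtr_gt0 ltr0n.
have sn : s <= 8 * n%:R.
  rewrite ler_pM2l// -[leRHS]ger0_norm// -sqrtr_sqr ler_wsqrtr//.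
  by rewrite expr2 ler_peMr// ler1n.
have uu : inner u u <= 1 by rewrite -enorm_sqr exprn_ile1// enorm_ge0.
have ui i : `|u i 0| <= 1.
  rewrite -(@ler_pXn2r _ 2) ?nnegrE// expr1n real_normK ?num_real//.
  apply: le_trans uu; rewrite /inner (bigD1 i)//= -expr2 lerDl sumr_ge0// => j _.
  by rewrite -expr2 sqr_ge0.
pose k i := Num.truncn (`|u i 0| * s).
have kP i : (k i)%:R <= `|u i 0| * s < (k i).+1%:R.
  by apply: Num.Theory.truncn_itv; rewrite mulr_ge0// ltW.
have kn i : (k i < (8 * n).+1)%N.
  rewrite ltnS -(ler_nat R) natrM; have /andP[h _] := kP i; apply: le_trans h _.
  by apply: le_trans sn; rewrite ler_piMl// ltW.
pose z : grid_index n := [ffun i => (u i 0 < 0, Ordinal (kn i))].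
exists z.
  rewrite inE -(ler_nat R) natr_sum.
  apply: (@le_trans _ _ (\sum_i s ^+ 2 * (u i 0 * u i 0))).
    apply: ler_sum => i _; rewrite ffunE/= natrX -expr2 -exprMn.
    rewrite -[leRHS]real_normK ?num_real// ler_pXn2r ?nnegrE// normrM mulrC.
    by rewrite (gtr0_norm s0); have /andP[] := kP i.
  by rewrite -mulr_sumr s2 natrM -[leRHS]mulr1 ler_wpM2l// mulr_ge0.
apply: enorm_le => //.
apply: (@le_trans _ _ (\sum_(i < n) s ^- 2)); last first.
  rewrite sumr_const card_ord -(mulr_natr _ n) s2 invfM -mulrA mulVf ?mulr1.
    by rewrite exprVn -natrX.
  by rewrite pnatr_eq0 -lt0n.
apply: ler_sum => i _; rewrite -expr2 !mxE ffunE /= -/s.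
rewrite -[leLHS]real_normK ?num_real// -exprVn ler_pXn2r ?nnegrE// ?invr_ge0 ?(ltW s0)//.
(* [u i 0] and its rounding carry the same sign, so only the absolute values need comparing. *)
rewrite {1}(realEsign (num_real (u i 0))) -mulrA -mulrBr normrM normr_sign mul1r.
rewrite -(ler_pM2r s0) mulVf ?gt_eqF// -{2}(gtr0_norm s0) -normrM mulrBl mulfVK ?gt_eqF//.
have /andP[h1 h2] := kP i; rewrite ger0_norm ?subr_ge0//.
by rewrite lerBlDr; apply: ltW; rewrite addrC natr1.
Qed.

Lemma opnorm_le_grid n (A : 'M[R]_n) (m : R) : A^T = A ->
  (forall z, z \in grid_ball n ->
     `|inner (grid_point z) (A *m grid_point z)| <= m) ->
  opnorm A <= 4 * m.
Proof.
move=> sA hm; apply: (@opnorm_le_net _ _ _ (@grid_point n @` [set` grid_ball n])).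
- exact: sA.
- move=> u /grid_net[z zn uz]; exists (grid_point z); first by exists z.
  by split => //; exact: enorm_grid_point.
- by move=> _ [z /= zn <-]; exact: hm.
Qed.

End Grid.

(** * Integrals of products of independent variables *)

Section Integral.
Context {d : measure_display} {T : measurableType d} {R : realType}.
Variable mu : {measure set T -> \bar R}.

(* Unlike [ge0_le_integral], no measurability: the integral of a nonnegative
   function is a supremum over the simple functions below it. *)
Lemma ge0_le_integral_nomeas (f g : T -> \bar R) :
  (forall x, (0 <= f x)%E) -> (forall x, (f x <= g x)%E) ->
  (\int[mu]_x f x <= \int[mu]_x g x)%E.
Proof.
move=> f0 fg; have g0 x : (0 <= g x)%E := le_trans (f0 x) (fg x).
rewrite !ge0_integralTE//; apply: ereal_sup_le => _ [h hf <-].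
by exists h => // x; exact: le_trans (hf x) (fg x).
Qed.

End Integral.

Section Factorization.
Context {d d' : measure_display} {T : measurableType d} {T' : measurableType d'}.
Context {R : realType}.
Variables (mu : {measure set T -> \bar R}) (Y : {mfun T >-> T'}).
Local Open Scope ereal_scope.

Import HBNNSimple.

Let mcomp_indic (A : set T') : measurable A ->
  measurable_fun setT (fun w => \1_A (Y w) : R).
Proof.
move=> mA; apply: (measurableT_comp (f := \1_A : T' -> R)) => //.
Qed.

Lemma integral_weighted_nnsfun (G : T -> R) (h : {nnsfun T' >-> R}) :
  measurable_fun setT G -> (forall w, (0 <= G w)%R) ->
  \int[mu]_w (G w * h (Y w))%:E =
  \sum_(r \in range h) r%:E * \int[mu]_w (G w * \1_(h @^-1` [set r]) (Y w))%:E.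
Proof.
move=> mG G0.
have mI r : measurable_fun setT (fun w => \1_(h @^-1` [set r]) (Y w) : R).
  exact: mcomp_indic.
transitivity (\int[mu]_w (\sum_(r \in range h)
    ((G w)%:E * (r * \1_(h @^-1` [set r]) (Y w))%:E))).
  apply: eq_integral => w _; rewrite fimfunE -ge0_mule_fsumr.
    by rewrite fsumEFin.
  by move=> r; exact: nnfun_muleindic_ge0.
rewrite ge0_integral_fsum//; last 2 first.
- move=> r; apply/measurable_EFinP.
  by apply: measurable_funM => //; exact: measurable_funM.
- move=> r w _; rewrite mule_ge0//; first by rewrite lee_fin.
  exact: nnfun_muleindic_ge0.
apply: eq_fsbigr => r; rewrite inE => -[y _ <-].
rewrite -ge0_integralZl_EFin//.
- by apply: eq_integral => w _; rewrite -!EFinM mulrCA.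
- by move=> w _; rewrite lee_fin mulr_ge0.
- by apply/measurable_EFinP; exact: measurable_funM.
Qed.

Lemma integral_weighted_approx (G : T -> R) (f : T' -> R)
    (mf : measurable_fun setT (EFin \o f)) :
  measurable_fun setT G -> (forall w, (0 <= G w)%R) ->
  (forall y, (0 <= f y)%R) ->
  (fun n => \int[mu]_w (G w * nnsfun_approx measurableT mf n (Y w))%:E)
    @ \oo --> \int[mu]_w (G w * f (Y w))%:E.
Proof.
move=> mG G0 f0; set h := nnsfun_approx measurableT mf.
have -> : \int[mu]_w (G w * f (Y w))%:E =
    \int[mu]_w limn (fun n => (G w * h n (Y w))%:E).
  apply: eq_integral => w _; apply/esym/cvg_lim => //.
  rewrite EFinM; under eq_fun do rewrite EFinM.
  apply: cvgeZl => //.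
  by apply: (cvg_nnsfun_approx measurableT mf) => // y _; rewrite lee_fin.
apply: cvg_monotone_convergence => //.
- move=> n; apply/measurable_EFinP; apply: measurable_funM => //.
  exact: measurableT_comp.
- by move=> n w _; rewrite lee_fin mulr_ge0.
- move=> w _ m n mn; rewrite lee_fin ler_wpM2l//.
  by move/lefP: (nd_nnsfun_approx measurableT mf mn); exact.
Qed.

(** The hypothesis on indicators extends by linearity to simple functions and by monotone
    convergence to [f]. In the application [G] is the product of the other factors and [c] the
    product of their integrals. *)
Lemma integral_weighted_factor (G : T -> R) (c : R) (f : T' -> R) :
  measurable_fun setT G -> (forall w, (0 <= G w)%R) ->
  measurable_fun setT f -> (forall y, (0 <= f y)%R) ->
  (forall A, measurable A ->
     \int[mu]_w (G w * \1_A (Y w))%:E = c%:E * \int[mu]_w (\1_A (Y w))%:E) ->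
  \int[mu]_w (G w * f (Y w))%:E = c%:E * \int[mu]_w (f (Y w))%:E.
Proof.
move=> mG G0 mf f0 GA; have mf' : measurable_fun setT (EFin \o f).
  exact/measurable_EFinP.
have one (g : T' -> R) w : (1 * g (Y w))%R = g (Y w) by rewrite mul1r.
have simple (h : {nnsfun T' >-> R}) :
    \int[mu]_w (G w * h (Y w))%:E = c%:E * \int[mu]_w (h (Y w))%:E.
  rewrite integral_weighted_nnsfun//.
  under [in RHS]eq_integral do rewrite -(one h).
  (* The right-hand side gets the same expansion with weight 1. Distributing [c] over it requires
     nonnegative terms: for r < 0 the level set of [h] is empty. *)
  rewrite (@integral_weighted_nnsfun (cst 1%R))// ge0_mule_fsumr; last first.
    move=> r; under eq_integral do rewrite /= mul1r.
    have [r0|r0] := leP 0%R r.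
      by rewrite mule_ge0// integral_ge0// => w _; rewrite lee_fin.
    rewrite preimage_nnfun0//; under eq_integral do rewrite indic0.
    by rewrite integral0 mule0.
  apply: eq_fsbigr => r _; rewrite GA// muleCA; congr (_ * (_ * _)).
  by apply: eq_integral => w _; rewrite /= mul1r.
pose h := nnsfun_approx measurableT mf'.
have := integral_weighted_approx mf' mG G0 f0.
rewrite (_ : (fun n => _) = (fun n => c%:E * \int[mu]_w (h n (Y w))%:E)); last first.
  by apply/funext => n; exact: simple.
move=> cv; apply: (cvg_unique _ cv) => //; apply: cvgeZl => //.
have := @integral_weighted_approx (cst 1%R) f mf' (@measurable_cst _ _ _ _ _ _)
  (fun=> ler01) f0.
under [in X in _ --> X -> _]eq_integral do rewrite one.
by under [in X in X @ _ --> _ -> _]eq_fun do under eq_integral do rewrite one.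
Qed.

End Factorization.

Section Independence.
Context {d d' : measure_display} {T : measurableType d} {T' : measurableType d'}.
Context {R : realType} (P : probability T R).
Local Open Scope ereal_scope.

(** Induction on the list of indices carrying [f i], the other indices carrying indicators. For the
    empty list this is the definition of independence; each step turns one indicator into a function
    by [integral_weighted_factor]. Finite integrals keep the constant there real. *)
Lemma integral_prod_independent (I : finType) (Y : I -> {mfun T >-> T'})
    (f : I -> T' -> R) :
  mutually_independent P Y ->
  (forall i, measurable_fun setT (f i)) -> (forall i y, (0 <= f i y)%R) ->
  (forall i, \int[P]_w (f i (Y i w))%:E < +oo) ->
  \int[P]_w (\prod_i f i (Y i w))%:E = \prod_i \int[P]_w (f i (Y i w))%:E.
Proof.
move=> indY mf f0 foo.
pose g (s : seq I) (A : I -> set T') i : T' -> R :=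
  if i \in s then f i else \1_(A i).
have mg s A i : (forall i, measurable (A i)) -> measurable_fun setT (g s A i).
  by move=> mA; rewrite /g; case: ifP.
have g0 s A i y : (0 <= g s A i y)%R by rewrite /g; case: ifP.
have goo s A i : \int[P]_w (g s A i (Y i w))%:E < +oo.
  rewrite /g; case: ifP => // _; apply: (@le_lt_trans _ _ (\int[P]_w (cst 1 w))).
    by apply: ge0_le_integral_nomeas => w; rewrite lee_fin//.
  by rewrite integral_cst// mul1e (le_lt_trans (probability_le1 P measurableT))// ltry.
suff H : forall (s : seq I) A, uniq s -> (forall i, measurable (A i)) ->
    \int[P]_w (\prod_i g s A i (Y i w))%:E = \prod_i \int[P]_w (g s A i (Y i w))%:E.
  have := H (enum I) (fun=> setT) (enum_uniq _) (fun=> measurableT).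
  rewrite /g; under eq_integral do under eq_bigr do rewrite mem_enum.
  move=> ->; apply: eq_bigr => i _; apply: eq_integral => w _.
  by rewrite mem_enum.
elim=> [|k s ih] A us mA.
  under [RHS]eq_bigr => i _.
    rewrite (_ : \int[P]_w _ = P (Y i @^-1` A i)); first over.
    rewrite /g/= (_ : (fun w => _) = (EFin \o \1_(Y i @^-1` A i))); last first.
      by apply/funext => w.
    rewrite integral_indic ?setIT//.
    by rewrite -[X in measurable X]setTI; exact: measurable_funPT.
  have := indY [set: I]%SET A mA.
  under [in RHS]eq_bigl do rewrite inE.
  move=> <-; set B := \bigcap_(i in _) _.
  have mB : measurable B.
    apply: fin_bigcap_measurable => [|i _]; first exact: finite_finset.
    by rewrite -[X in measurable X]setTI; exact: measurable_funPT.
  rewrite -[B in RHS]setIT -integral_indic//; apply: eq_integral => w _.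
  congr EFin; rewrite /g/= indicE; case: (boolP (w \in B)) => wB.
    rewrite big1// => i _; rewrite indicE mem_set//.
    by move/set_mem: wB; apply; rewrite /= inE.
  have /existsNP[i /= Ai] : ~ (forall i, A i (Y i w)).
    by move=> h; move/negP: wB; apply; apply/mem_set => i _; exact: h.
  by rewrite (bigD1 i)//= indicE memNset// mul0r.
move: us => /= /andP[ks us].
have gk : g (k :: s) A k = f k by rewrite /g mem_head.
have gi i : i != k -> g (k :: s) A i = g s A i by rewrite /g inE => /negbTE ->.
pose G w := (\prod_(i | i != k) g s A i (Y i w))%R.
pose c := \prod_(i | i != k) \int[P]_w (g s A i (Y i w))%:E.
have cfin : c \is a fin_num.
  apply: prode_fin_num => i _; rewrite ge0_fin_numE ?goo//.
  by apply: integral_ge0 => w _; rewrite lee_fin.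
have mG : measurable_fun setT G.
  have -> : G = fun w => (\prod_i if i != k then g s A i (Y i w) else 1)%R.
    by apply/funext => w; rewrite /G big_mkcond.
  apply: measurable_prod => i _; case: (i != k).
    by apply: (measurableT_comp (f := g s A i)) => //; exact: mg.
  exact: measurable_cst.
have G0 w : (0 <= G w)%R by exact: prodr_ge0.
rewrite [RHS](bigD1 k)//= gk muleC.
rewrite (eq_bigr (fun i => \int[P]_w (g s A i (Y i w))%:E)); last first.
  by move=> i ik; rewrite gi.
rewrite -/c -(fineK cfin) -(@integral_weighted_factor _ _ _ _ _ _ (Y k) G)//.
- apply: eq_integral => w _; rewrite (bigD1 k)//= gk mulrC; congr (_ * _)%:E.
  by apply: eq_bigr => i ik; rewrite gi.
- move=> B mB; rewrite (fineK cfin).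
  (* As [k] is not in [s], the induction hypothesis with [B] as the set at [k] is the factorization
     on indicators that is required. *)
  pose A' i := if i == k then B else A i.
  have mA' i : measurable (A' i) by rewrite /A'; case: ifP.
  have gA'k : g s A' k = \1_B by rewrite /g (negbTE ks) /A' eqxx.
  have gA'i i : i != k -> g s A' i = g s A i by rewrite /g /A' => /negbTE ->.
  have := ih A' us mA'; rewrite [RHS](bigD1 k)//= gA'k muleC.
  rewrite (eq_bigr (fun i => \int[P]_w (g s A i (Y i w))%:E)); last first.
    by move=> i ik; rewrite gA'i.
  rewrite -/c => <-; apply: eq_integral => w _.
  rewrite (bigD1 k)//= gA'k mulrC; congr (_ * _)%:E.
  by apply: eq_bigr => i ik; rewrite gA'i.
Qed.

End Independence.

(** * Moment generating functions *)

(** From 1 + s <= e^s follow |e^t - 1| <= |t| e^|t| and e^t - 1 - t <= t (e^t - 1); combining them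
    bounds the remainder. *)
Lemma expR_le_quad (R : realType) (t : R) :
  expR t <= 1 + t + t ^+ 2 * expR `|t|.
Proof.
have h1 (s : R) : (1 - s) * expR s <= 1.
  have /(ler_wpM2r (expR_ge0 s)) := expR_ge1Dx (- s).
  by rewrite -expRD addNr expR0.
have h2 : `|expR t - 1| <= `|t| * expR `|t|.
  have [t0|t0] := leP 0 t.
    rewrite !ger0_norm//; last by rewrite subr_ge0 -[leLHS]expR0 ler_expR.
    by have := h1 t; rewrite mulrBl mul1r; lra.
  have ht : 1 <= expR `|t| by rewrite -expR0 ler_expR.
  rewrite distrC ger0_norm; last by rewrite subr_ge0 -[leRHS]expR0 ler_expR ltW.
  apply: (@le_trans _ _ `|t|); last exact: ler_peMr.
  by rewrite ltr0_norm//; have := expR_ge1Dx t; lra.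
have h3 : expR t - 1 - t <= t * (expR t - 1) by have := h1 t; lra.
have h4 : t * (expR t - 1) <= t ^+ 2 * expR `|t|.
  apply: (le_trans (ler_norm _)); rewrite normrM -real_normK ?num_real// expr2.
  by rewrite -mulrA ler_wpM2l.
lra.
Qed.

(** With a = (y + 1) / 2, the exponent is at most a in absolute value, (y - m)^2 <= (y + 1)^2 <= 16
    e^a, and e^a e^a = e e^y. The bound 1/2 on |l| leaves room for the quadratic factor within a
    single e^y. *)
Lemma expR_centered_le (R : realType) (l y m : R) :
  `|l| <= 2^-1 -> 0 <= y -> 0 <= m <= 1 ->
  expR (l * (y - m)) <= 1 + l * (y - m) + 16 * expR 1 * l ^+ 2 * expR y.
Proof.
move=> l2 y0 /andP[m0 m1]; apply: (le_trans (expR_le_quad _)).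
rewrite lerD2l; set a := (y + 1) / 2.
have ym : `|y - m| <= y + 1 by rewrite ler_norml; apply/andP; split; lra.
have ta : `|l * (y - m)| <= a.
  by rewrite normrM /a [leRHS]mulrC ler_pM.
have sq : (y - m) ^+ 2 <= 16 * expR a.
  apply: (@le_trans _ _ ((y + 1) ^+ 2)).
    by rewrite -real_normK ?num_real// ler_pXn2r ?nnegrE// addr_ge0.
  have h : (y + 1) / 4 <= expR ((y + 1) / 4).
    by have := expR_ge1Dx ((y + 1) / 4); lra.
  have -> : a = (y + 1) / 4 + (y + 1) / 4 by rewrite /a; field.
  have h0 : 0 <= (y + 1) / 4 by lra.
  by rewrite expRD; nra.
rewrite exprMn -[leLHS]mulrA.
have -> : 16 * expR 1 * l ^+ 2 * expR y = l ^+ 2 * ((16 * expR a) * expR a).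
  have -> : y = a + a - 1 by rewrite /a; field.
  rewrite expRB expRD; field.
  by rewrite gt_eqF// expR_gt0.
rewrite ler_wpM2l ?sqr_ge0// ler_pM ?sqr_ge0 ?expR_ge0// ler_expR.
exact: ta.
Qed.

Section Mgf.
Context {d : measure_display} {T : measurableType d} {R : realType}.
Variable P : probability T R.

(** The linear term of [expR_centered_le] integrates to zero, E e^Y <= 2 turns 16 e into 32 e, and 1
    + x <= e^x concludes. The mean is at most 1 because 1 + Y <= e^Y. *)
Lemma mgf_centered_le (Y : T -> R) (l : R) :
  measurable_fun setT Y -> (forall w, 0 <= Y w) ->
  (\int[P]_w (expR (Y w))%:E <= 2%:E)%E -> `|l| <= 2^-1 ->
  (\int[P]_w (expR (l * (Y w - fine (\int[P]_w (Y w)%:E))))%:E <=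
    (expR (32 * expR 1 * l ^+ 2))%:E)%E.
Proof.
move=> mY Y0 E2 l2.
have mE : measurable_fun setT (fun w => expR (Y w)).
  exact: measurableT_comp.
have iE : P.-integrable setT (fun w => (expR (Y w))%:E).
  apply/integrableP; split; first exact/measurable_EFinP.
  under eq_integral do rewrite gee0_abs ?lee_fin ?expR_ge0//.
  by apply: le_lt_trans E2 _; rewrite ltry.
have iY : P.-integrable setT (fun w => (Y w)%:E).
  apply: le_integrable iE => //; first exact/measurable_EFinP.
  move=> w _ /=; rewrite lee_fin !ger0_norm ?expR_ge0//.
  by have := expR_ge1Dx (Y w); lra.
set m := fine _; set e := fine (\int[P]_w (expR (Y w))%:E)%E.
have mI : (\int[P]_w (Y w)%:E = m%:E)%E by rewrite fineK// integrable_fin_num.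
have eI : (\int[P]_w (expR (Y w))%:E = e%:E)%E.
  by rewrite fineK// integrable_fin_num.
have lin (a b c : R) : (\int[P]_w (a + b * Y w + c * expR (Y w))%:E =
    (a + b * m + c * e)%:E)%E.
  have ia : P.-integrable setT (fun=> a%:E).
    exact: finite_measure_integrable_cst.
  have ib := integrableZl measurableT b iY.
  have ic := integrableZl measurableT c iE.
  under eq_integral do rewrite EFinD EFinD !EFinM.
  rewrite (integralD measurableT (integrableD measurableT ia ib) ic).
  rewrite (integralD measurableT ia ib) !integralZl// mI eI.
  rewrite (integral_cst P measurableT a%:E).
  by rewrite [X in (_ * X)%E]probability_setT mule1.
have e2 : e <= 2 by rewrite -lee_fin -eI.
have m0 : 0 <= m by rewrite fine_ge0// integral_ge0// => w _; rewrite lee_fin.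
have m1 : m <= 1.
  suff : 1 + m <= e by lra.
  have := lin 1 1 0; rewrite mul1r mul0r addr0 -lee_fin => <-.
  rewrite -eI; apply: ge0_le_integral_nomeas => w; rewrite lee_fin.
    by rewrite mul1r mul0r addr0 addr_ge0.
  by rewrite mul1r mul0r addr0 expR_ge1Dx.
apply: (@le_trans _ _ (\int[P]_w
    ((1 - l * m) + l * Y w + 16 * expR 1 * l ^+ 2 * expR (Y w))%:E)%E).
  apply: ge0_le_integral_nomeas => w; rewrite lee_fin ?expR_ge0//.
  apply: (le_trans (expR_centered_le l2 (Y0 w) _)); first by rewrite m0 m1.
  by rewrite mulrBr; lra.
rewrite lin lee_fin; apply: le_trans (expR_ge1Dx _).
have c0 : 0 <= 16 * expR 1 * l ^+ 2.
  by rewrite mulr_ge0 ?sqr_ge0// mulr_ge0 ?expR_ge0.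
have := ler_wpM2l c0 e2; lra.
Qed.

(** Strictness provides an admissible t below [K], and the exponential moment decreases as t
    grows. *)
Lemma psi2norm_lt_expectation (Z : T -> R) (K : R) :
  (psi2norm P Z < K%:E)%E -> (\int[P]_w (expR (Z w ^+ 2 / K ^+ 2))%:E <= 2%:E)%E.
Proof.
move=> /ereal_inf_lt[_ [t [t0 tE] <-] tK]; rewrite lte_fin in tK.
rewrite unlock in tE; apply: le_trans tE.
apply: ge0_le_integral_nomeas => w; rewrite lee_fin ?expR_ge0// ler_expR.
rewrite ler_wpM2l ?sqr_ge0// lef_pV2 ?posrE ?exprn_gt0// ?(lt_trans t0 tK)//.
by rewrite ler_pXn2r ?nnegrE ?ltW// (lt_trans t0 tK).
Qed.

End Mgf.

(** * Second moments of a sub-gaussian vector *)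

Section Covariance.
Context {d : measure_display} {T : measurableType d} {R : realType}.
Variable P : probability T R.

Lemma measurable_inner n (x : 'cV[R]_n) :
  measurable_fun setT (fun v : n.-tuple R => inner (\col_i tnth v i) x).
Proof.
apply: measurable_sum => i; apply: measurable_funM => //.
by under eq_fun do rewrite mxE; exact: measurable_tnth.
Qed.

(** Basis vectors show that each coordinate is square-integrable; products follow from |a b| <= a^2
    + b^2. *)
Lemma subgaussian_vector_integrable n (X : {RV P >-> n.-tuple R}) :
  subgaussian_vector X -> forall i j,
  P.-integrable setT (fun w => (tnth (X w) i * tnth (X w) j)%:E).
Proof.
move=> sgX i j.
have mX k : measurable_fun setT (fun w => tnth (X w) k).
  exact: (measurableT_comp (measurable_tnth k)).
have iX2 k : P.-integrable setT (fun w => (tnth (X w) k ^+ 2)%:E).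
  apply: subgaussian_integrable_sqr => //.
  have := sgX (delta_mx k 0); congr subgaussian; apply/funext => w.
  rewrite /inner (bigD1 k)//= big1 ?addr0 => [|l lk].
    by rewrite !mxE !eqxx mulr1.
  by rewrite !mxE (negbTE lk) mulr0.
apply: le_integrable (integrableD measurableT (iX2 i) (iX2 j)) => //.
  by apply/measurable_EFinP; exact: measurable_funM.
move=> w _ /=; rewrite lee_fin [leRHS]ger0_norm ?addr_ge0 ?sqr_ge0// ler_norml.
by apply/andP; split; nra.
Qed.

(** Integrability of the coordinate products ensures that [fine] in [mean_mx] loses nothing and that
    the double sum can be integrated termwise. *)
Lemma inner_covmx n (X : {RV P >-> n.-tuple R}) (x : 'cV[R]_n) :
  subgaussian_vector X ->
  (\int[P]_w (inner (vec X w) x ^+ 2)%:E = (inner x (covmx X *m x))%:E)%E.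
Proof.
move=> sgX; have iXX := subgaussian_vector_integrable sgX.
have covE i j : (\int[P]_w (tnth (X w) i * tnth (X w) j)%:E)%E =
    (covmx X i j)%:E.
  rewrite mxE unlock fineK.
    apply: eq_integral => w _; congr EFin.
    by rewrite !mxE big_ord1 !mxE.
  under eq_integral do rewrite mxE big_ord1 !mxE.
  exact: integrable_fin_num.
transitivity (\int[P]_w \sum_(p : 'I_n * 'I_n)
      ((x p.1 0 * x p.2 0)%:E * (tnth (X w) p.1 * tnth (X w) p.2)%:E))%E.
  apply: eq_integral => w _ /=.
  rewrite sumEFin; congr EFin.
  rewrite expr2 /inner big_distrlr pair_bigA/=; apply: eq_bigr => p _.
  by rewrite !mxE mulrACA mulrC.
rewrite integral_sum//; last by move=> p; exact: integrableZl.
under eq_bigr do rewrite integralZl// covE -EFinM.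
rewrite sumEFin; congr EFin; rewrite /inner.
under [RHS]eq_bigr do rewrite mxE mulr_sumr.
rewrite pair_bigA/=; apply: eq_bigr => p _.
by rewrite -mulrA; congr (_ * _); rewrite mulrC.
Qed.

Lemma covmx_sym n (X : {RV P >-> n.-tuple R}) : (covmx X)^T = covmx X.
Proof.
apply/matrixP => i j; rewrite !mxE; congr (fine 'E_P[_])%E; apply/funext => w.
by rewrite !mxE !big_ord1 !mxE mulrC.
Qed.

(** This turns the direction-dependent sub-gaussian hypothesis into one scale for the whole unit
    ball. *)
Lemma L2norm_inner_le n (X : {RV P >-> n.-tuple R}) (x : 'cV[R]_n) :
  subgaussian_vector X -> enorm x <= 1 ->
  (L2norm P (fun w => inner (vec X w) x) <= (Num.sqrt (opnorm (covmx X)))%:E)%E.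
Proof.
move=> sgX x1; rewrite /L2norm unlock poweR12_sqrt; last first.
  by apply: integral_ge0 => w _; exact: poweR_ge0.
have -> : (\int[P]_w (`|(EFin \o (fun w => inner (vec X w) x)) w| `^ 2))%E =
    (\int[P]_w (inner (vec X w) x ^+ 2)%:E)%E.
  apply: eq_integral => w _ /=.
  by rewrite powR_mulrn// real_normK ?num_real.
rewrite inner_covmx//= lee_fin ler_wsqrtr//.
apply: (le_trans (ler_norm _)); apply: (le_trans (normr_bilinear_le _ _ _)).
rewrite -mulrA -[leRHS]mulr1 ler_wpM2l ?opnorm_ge0//.
by rewrite mulr_ile1 ?enorm_ge0.
Qed.

End Covariance.

(** * Sample covariance *)

Section SampleCovariance.
Context {d : measure_display} {T : measurableType d} {R : realType}.
Variable P : probability T R.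

Lemma sample_covmx_sym n N (Xs : 'I_N -> {RV P >-> n.-tuple R}) w :
  (sample_covmx Xs w)^T = sample_covmx Xs w.
Proof.
rewrite /sample_covmx linearZ/= linear_sum/=; congr (_ *: _).
by apply: eq_bigr => i _; rewrite trmx_mul trmxK.
Qed.

Lemma inner_sample_covmx n N (Xs : 'I_N -> {RV P >-> n.-tuple R}) w y :
  inner y (sample_covmx Xs w *m y) =
  N%:R^-1 * \sum_i inner (vec (Xs i) w) y ^+ 2.
Proof.
rewrite /sample_covmx -scalemxAl innerZr mulmx_suml inner_sumr.
by under eq_bigr do rewrite inner_outer.
Qed.

Lemma integral_copy d' (T' : measurableType d') (X Y : {RV P >-> T'})
    (f : T' -> R) :
  (forall A, measurable A -> distribution P Y A = distribution P X A) ->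
  measurable_fun setT f -> (forall x, 0 <= f x) ->
  (\int[P]_w (f (Y w))%:E = \int[P]_w (f (X w))%:E)%E.
Proof.
move=> XY mf f0; have mf' : measurable_fun setT (EFin \o f).
  exact/measurable_EFinP.
rewrite -[LHS](ge0_integral_distribution Y mf') => [|x]; last by rewrite lee_fin.
rewrite -[RHS](ge0_integral_distribution X mf') => [|x]; last by rewrite lee_fin.
by apply: eq_measure_integral => A mA _; exact: XY.
Qed.

(** The exponential of the sum is a product over the sample, which independence splits; each factor
    has the law given by [X] and obeys [mgf_centered_le]. *)
Lemma mgf_sum_copies d' (T' : measurableType d') N (X : {RV P >-> T'})
    (Xs : 'I_N -> {RV P >-> T'}) (q : T' -> R) (l : R) :
  mutually_independent P Xs ->
  (forall i A, measurable A -> distribution P (Xs i) A = distribution P X A) ->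
  measurable_fun setT q -> (forall x, 0 <= q x) ->
  (\int[P]_w (expR (q (X w)))%:E <= 2%:E)%E -> `|l| <= 2^-1 ->
  (\int[P]_w (expR (l * \sum_i
      (q (Xs i w) - fine (\int[P]_w (q (X w))%:E))))%:E <=
    (expR (N%:R * (32 * expR 1 * l ^+ 2)))%:E)%E.
Proof.
move=> indX copX mq q0 q2 l2; set m := fine _.
pose f x : R := expR (l * (q x - m)).
have mf : measurable_fun setT f.
  apply: measurableT_comp => //; apply: measurable_funM => //.
  exact: measurable_funB.
have f0 x : 0 <= f x by exact: expR_ge0.
have mgf i : (\int[P]_w (f (Xs i w))%:E <= (expR (32 * expR 1 * l ^+ 2))%:E)%E.
  rewrite (integral_copy (copX i) mf f0).
  apply: (@mgf_centered_le _ _ _ P (fun w => q (X w))) => //.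
  exact: measurableT_comp.
have If i : (0 <= \int[P]_w (f (Xs i w))%:E)%E.
  by apply: integral_ge0 => w _; rewrite lee_fin.
have oo i : (\int[P]_w (f (Xs i w))%:E < +oo)%E.
  by apply: le_lt_trans (mgf i) _; rewrite ltry.
have fE i : (\int[P]_w (f (Xs i w))%:E =
    (fine (\int[P]_w (f (Xs i w))%:E))%:E)%E.
  by rewrite fineK// ge0_fin_numE.
under eq_integral do rewrite mulr_sumr expR_sum.
rewrite (integral_prod_independent (f := fun=> f) indX)//.
rewrite (eq_bigr _ (fun i _ => fE i)) prodEFin lee_fin.
rewrite expRM_natl -[X in _ ^+ X]card_ord -prodr_const.
by apply: ler_prod => i _; rewrite fine_ge0//= -lee_fin -fE.
Qed.

End SampleCovariance.

(* Exponential form of the union bound; no measurable maximum is needed. *)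
Lemma normr_le_sum_expR (R : realType) (I : finType) (S : {set I})
    (D : I -> R) (l a : R) (z : I) : 0 <= l -> z \in S ->
  l * `|D z| <= a - 1 + \sum_(z in S) (expR (l * D z - a) + expR (- l * D z - a)).
Proof.
move=> l0 zS; rewrite (bigD1 z)//=.
have rest : 0 <= \sum_(i in S | i != z)
    (expR (l * D i - a) + expR (- l * D i - a)).
  by apply: sumr_ge0 => i _; rewrite addr_ge0 ?expR_ge0.
(* For the sign that makes the exponent l |D z| - a, 1 + x <= e^x gives the claim; the remaining
   exponentials are nonnegative. *)
have h1 := expR_ge1Dx (l * D z - a); have h2 := expR_ge1Dx (- l * D z - a).
have h3 := expR_ge0 (l * D z - a); have h4 := expR_ge0 (- l * D z - a).
by have [D0|D0] := ger0P (D z); lra.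
Qed.

(** With l = sqrt r / 2 both terms are of order sqrt r. For r > 1 this exceeds the allowed 1/2, so l
    = 1/2 is taken and c / 2 is absorbed by c r / 2. *)
Lemma rate_le (R : realType) (c r : R) : 0 <= c -> 0 < r ->
  exists2 l, 0 < l <= 2^-1 &
    c * l + 67 * r / l <= (c / 2 + 134) * (Num.sqrt r + r).
Proof.
move=> c0 r0; set s := Num.sqrt r; have s0 : 0 < s by rewrite sqrtr_gt0.
have rs : r = s * s by rewrite -expr2 sqr_sqrtr// ltW.
have [s1|s1] := leP s 1.
  exists (s / 2); first by apply/andP; split; lra.
  have -> : 67 * r / (s / 2) = 134 * s by rewrite rs; field; rewrite gt_eqF.
  by have := mulr_ge0 c0 (ltW r0); lra.
exists 2^-1; first by rewrite lexx andbT invr_gt0.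
have r1 : 1 < r by rewrite rs; nra.
rewrite invrK; have := ler_wpM2l c0 (ltW r1).
by have := mulr_ge0 c0 (ltW s0); lra.
Qed.

(** * Union bound over the net at a fixed scale *)

Section Bound.
Context {d : measure_display} {T : measurableType d} {R : realType}.
Variable P : probability T R.

(** The scale [K] is left free so that it can later approach its limiting value from above. *)
Lemma expectation_opnorm_le n N (X : {RV P >-> n.-tuple R})
    (Xs : 'I_N -> {RV P >-> n.-tuple R}) (K : R) :
  subgaussian_vector X -> independent_copies X Xs -> (0 < N)%N -> 0 < K ->
  (forall x : 'cV[R]_n, enorm x <= 1 ->
    (\int[P]_w (expR (inner (vec X w) x ^+ 2 / K ^+ 2))%:E <= 2%:E)%E) ->
  ('E_P[fun w => opnorm (sample_covmx Xs w - covmx X)] <=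
    (4 * K ^+ 2 * ((16 * expR 1 + 134) *
      (Num.sqrt (n%:R / N%:R) + n%:R / N%:R)))%:E)%E.
Proof.
move=> sgX [indX copX] N0 K0 hK; rewrite unlock.
(* In dimension 0 both sides vanish; otherwise n / N is positive, as [rate_le] requires. *)
have [n0|n0] := posnP n.
  subst n; under eq_integral do rewrite opnorm_dim0.
  by rewrite integral0 lee_fin mul0r sqrtr0 addr0 !mulr0.
have N0' : 0 < N%:R :> R by rewrite ltr0n.
have K2 : 0 < K ^+ 2 by rewrite exprn_gt0.
pose q (z : grid_index n) (v : n.-tuple R) : R :=
  inner (\col_i tnth v i) (grid_point z) ^+ 2 / K ^+ 2.
have mq z : measurable_fun setT (q z).
  apply: measurable_funM => //; apply: measurable_funX.
  exact: measurable_inner.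
have q0 z v : 0 <= q z v by rewrite divr_ge0 ?sqr_ge0.
pose m z := fine (\int[P]_w (q z (X w))%:E).
have mE z : m z = inner (grid_point z) (covmx X *m grid_point z) / K ^+ 2.
  rewrite /m /q; under eq_integral do rewrite mulrC EFinM.
  rewrite ge0_integralZl_EFin//.
  - by rewrite (inner_covmx _ sgX)/= mulrC.
  - by move=> w _; rewrite lee_fin sqr_ge0.
  - apply/measurable_EFinP/measurable_funX.
    exact: (measurableT_comp (measurable_inner _)).
  - by rewrite invr_ge0 ltW.
pose D z w := \sum_i (q z (Xs i w) - m z).
have mD z : measurable_fun setT (D z).
  apply: measurable_sum => i; apply: measurable_funB => //.
  exact: measurableT_comp.
have quad z w : inner (grid_point z)
    ((sample_covmx Xs w - covmx X) *m grid_point z) = K ^+ 2 / N%:R * D z w.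
  rewrite mulmxBl innerBr inner_sample_covmx /D sumrB sumr_const card_ord mE.
  rewrite -mulr_suml -(mulr_natr _ N) mulrBr; congr (_ - _).
    by rewrite /vec; field; rewrite !gt_eqF.
  by field; rewrite !gt_eqF.
pose r : R := n%:R / N%:R; have r0 : 0 < r by rewrite divr_gt0 ?ltr0n.
have c0 : 0 <= 32 * expR 1 :> R by rewrite mulr_ge0 ?expR_ge0.
have [l /andP[l0 l2] rate] := rate_le c0 r0.
(* The first term offsets the moment bound for the centred sums; the second leaves a factor e^(-67
   n), which outweighs twice the number of net points. *)
pose a := N%:R * (32 * expR 1 * l ^+ 2) + 67 * n%:R.
have a1 : 0 <= a - 1.
  have : 1 <= n%:R :> R by rewrite ler1n.
  have : 0 <= N%:R * (32 * expR 1 * l ^+ 2).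
    by rewrite mulr_ge0 ?ler0n// mulr_ge0 ?sqr_ge0.
  by rewrite /a; lra.
pose E z w := expR (l * D z w - a) + expR (- l * D z w - a).
have mExp (b : R) z : measurable_fun setT (fun w => expR (b * D z w - a)).
  apply: measurableT_comp => //; apply: measurable_funB => //.
  exact: measurable_funM.
have mE' z : measurable_fun setT (E z) by exact: measurable_funD.
have E0 z w : 0 <= E z w by rewrite addr_ge0 ?expR_ge0.
have intExp (b : R) z : z \in grid_ball n -> `|b| = l ->
    (\int[P]_w (expR (b * D z w - a))%:E <= (expR (- (67 * n%:R)))%:E)%E.
  move=> zn bl; have b2 : `|b| <= 2^-1 by rewrite bl.
  have bb : b ^+ 2 = l ^+ 2 by rewrite -bl real_normK ?num_real.
  under eq_integral do rewrite expRD mulrC EFinM.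
  rewrite ge0_integralZl_EFin ?expR_ge0//; last first.
    apply/measurable_EFinP; apply: measurableT_comp => //.
    exact: measurable_funM.
  have := mgf_sum_copies indX copX (mq z) (q0 z)
    (hK _ (enorm_grid_point zn)) b2.
  move=> /(lee_wpmul2l (_ : 0%:E <= (expR (- a))%:E)%E) h.
  apply: le_trans (h _) _; first by rewrite lee_fin expR_ge0.
  by rewrite -EFinM -expRD lee_fin ler_expR bb /a; lra.
(* The 4 comes from the net, K^2 / N from the rescaling in [quad], and 1 / l from dividing the
   exponential bound by l. *)
pose C : R := 4 * (K ^+ 2 / N%:R / l).
have C0 : 0 <= C.
  by rewrite mulr_ge0 ?divr_ge0 ?(ltW l0) ?(ltW K2) ?ler0n.
pose B w := C * (a - 1 + \sum_(z in grid_ball n) E z w).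
apply: (@le_trans _ _ (\int[P]_w (B w)%:E)%E).
  (* The operator norm is dominated pointwise by [B], so measurability is needed only for [B]. *)
  apply: ge0_le_integral_nomeas => w; rewrite lee_fin ?opnorm_ge0//.
  rewrite /B /C -mulrA; apply: opnorm_le_grid.
    by rewrite linearB/= sample_covmx_sym covmx_sym.
  move=> z zn; rewrite quad normrM gtr0_norm ?divr_gt0//.
  rewrite -[leRHS]mulrA ler_wpM2l ?divr_ge0 ?(ltW K2) ?ler0n// ler_pdivlMl//.
  exact: normr_le_sum_expR (ltW l0) zn.
have intE z : z \in grid_ball n ->
    (\int[P]_w (E z w)%:E <= (2 * expR (- (67 * n%:R)))%:E)%E.
  move=> zn; under eq_integral do rewrite EFinD.
  rewrite ge0_integralD//.
  - rewrite mulr2n mulrDl mul1r EFinD; apply: leeD; apply: intExp => //.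
      by rewrite gtr0_norm.
    by rewrite normrN gtr0_norm.
  - exact/measurable_EFinP.
  - exact/measurable_EFinP.
have sum0 w : 0 <= \sum_(z in grid_ball n) E z w by apply: sumr_ge0.
have msum : measurable_fun setT (fun w => \sum_(z in grid_ball n) E z w).
  have -> : (fun w => \sum_(z in grid_ball n) E z w) =
      fun w => \sum_(z <- enum (grid_ball n)) E z w.
    by apply/funext => w; rewrite big_enum.
  exact: measurable_sum.
have intB : (\int[P]_w (B w)%:E <= (C * a)%:E)%E.
  rewrite /B; under eq_integral do rewrite EFinM.
  rewrite ge0_integralZl_EFin//; last 2 first.
  - by move=> w _; rewrite lee_fin addr_ge0.
  - by apply/measurable_EFinP; exact: measurable_funD.
  rewrite [leRHS]EFinM lee_wpmul2l ?lee_fin//.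
  under eq_integral do rewrite EFinD.
  rewrite ge0_integralD//; last 2 first.
  - by move=> w _; rewrite lee_fin.
  - exact/measurable_EFinP.
  rewrite (integral_cst P measurableT (a - 1)%:E).
  rewrite [X in (_ * X + _)%E]probability_setT mule1.
  (* The expected exponentials add up to at most 1, which restores the 1 subtracted from [a]. *)
  rewrite (_ : a%:E = ((a - 1)%:E + 1%:E)%E); last by rewrite -EFinD subrK.
  rewrite leeD2l//.
  under eq_integral do rewrite -sumEFin -big_enum.
  rewrite ge0_integral_sum//; last 2 first.
  - by move=> z; exact/measurable_EFinP.
  - by move=> z w _; rewrite lee_fin.
  rewrite big_enum/=; apply: (@le_trans _ _
      (\sum_(z in grid_ball n) (2 * expR (- (67 * n%:R)))%:E)%E).
    by apply: lee_sum.
  rewrite sumEFin lee_fin sumr_const -(mulr_natr _ #|_|) mulrAC expRN.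
  by rewrite ler_pdivrMr ?expR_gt0// mul1r two_card_grid_le_expR.
apply: le_trans intB _; rewrite lee_fin.
have -> : C * a = 4 * K ^+ 2 * (32 * expR 1 * l + 67 * r / l).
  by rewrite /C /a /r; field; rewrite !gt_eqF.
rewrite ler_wpM2l ?mulr_ge0 ?(ltW K0)//.
by apply: le_trans rate _; rewrite -/r (_ : 32 * expR 1 / 2 = 16 * expR 1) //; field.
Qed.

End Bound.

(** * Passage to the limiting scale *)

Unset Implicit Arguments.

Theorem theorem4p4p1 (R : realType) (L : R) (hL : 0 < L) :
  exists C : R, 0 < C /\
    forall (d : measure_display) (T : measurableType d) (P : probability T R)
      (n : nat) (X : {RV P >-> n.-tuple R}),
      mean_zero X ->
      subgaussian_vector X ->
      (forall x : 'cV[R]_n,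
        (psi2norm P (fun w => inner (vec X w) x) <=
         L%:E * L2norm P (fun w => inner (vec X w) x))%E) ->
      forall (N : nat) (Xs : 'I_N -> {RV P >-> n.-tuple R}),
        (1 <= N)%N ->
        independent_copies X Xs ->
        ('E_P[fun w => opnorm (sample_covmx Xs w - covmx X)%R] <=
         (C * opnorm (covmx X) *
          (Num.sqrt (n%:R / N%:R) + n%:R / N%:R))%:E)%E.
Proof.
pose c : R := 16 * expR 1 + 134.
have c0 : 0 < c by rewrite addr_gt0// mulr_gt0// expR_gt0.
exists (4 * L ^+ 2 * c); split; first by rewrite !mulr_gt0// exprn_gt0.
move=> d T P n X _ sgX hX N Xs N0 cop.
set s := Num.sqrt (opnorm (covmx X)).
set B := Num.sqrt (n%:R / N%:R) + n%:R / N%:R.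
have s0 : 0 <= s by exact: sqrtr_ge0.
have s2 : opnorm (covmx X) = s ^+ 2 by rewrite sqr_sqrtr// opnorm_ge0.
have B0 : 0 <= B by rewrite addr_ge0 ?sqrtr_ge0// divr_ge0.
have Ls0 : 0 <= L * s by rewrite mulr_ge0// ltW.
have bound K : L * s < K ->
    ('E_P[fun w => opnorm (sample_covmx Xs w - covmx X)%R] <=
     (4 * c * B * K ^+ 2)%:E)%E.
  move=> LK; have K0 : 0 < K := le_lt_trans Ls0 LK.
  rewrite (_ : 4 * c * B * K ^+ 2 = 4 * K ^+ 2 * (c * B)); last by ring.
  apply: expectation_opnorm_le => // x x1; apply: psi2norm_lt_expectation.
  apply: le_lt_trans (hX x) _.
  apply: (@le_lt_trans _ _ (L * s)%:E); last by rewrite lte_fin.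
  by rewrite EFinM lee_wpmul2l ?lee_fin ?(ltW hL)//; exact: L2norm_inner_le.
rewrite (_ : _ * B = 4 * c * B * (L * s) ^+ 2); last by rewrite s2; ring.
(* [K] can only approach [L * s]: the latter may be [0], where [_ / K ^+ 2] is
   junk, and the infimum in [psi2norm] need not be attained. *)
apply/lee_addgt0Pr => e e0; set M := 4 * c * B.
have M0 : 0 <= M by rewrite mulr_ge0// mulr_ge0// ltW.
have M1 : 0 < M + 1 by lra.
have d0 : 0 < e / (M + 1) by rewrite divr_gt0.
(* Prescribing K^2 makes the excess M e / (M + 1), which is at most e. The added 1 matters because M
   = 0 when n = 0. *)
pose K := Num.sqrt ((L * s) ^+ 2 + e / (M + 1)).
have K2 : K ^+ 2 = (L * s) ^+ 2 + e / (M + 1).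
  by rewrite sqr_sqrtr// addr_ge0 ?sqr_ge0// ltW.
apply: (le_trans (bound K _)).
  by rewrite -(@ltr_pXn2r _ 2) ?nnegrE ?sqrtr_ge0// K2 ltrDl.
rewrite -EFinD lee_fin -/M K2 mulrDr lerD2l mulrCA -[leRHS]mulr1.
by rewrite ler_wpM2l ?(ltW e0)// ler_pdivrMr// mul1r lerDl.
Qed.
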